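(* Let $0<a\le b<1$, let $\alpha:\mathbf{R}\to[a,b]$ be continuous, let $0<H<1$ and $\lambda>0$. Let $X_{H,\alpha(x),\lambda}$ be the linear tempered fractional multistable motion and $Y(t)=X_{H,\alpha(x),\lambda}(t+1)-X_{H,\alpha(x),\lambda}(t)$ its noise. For $t_1,t,\theta_1,\theta_2\in\mathbf{R}$ set $$R_{t_1}(t)=\mathbf{E}\big[e^{i(\theta_1Y(t_1)+\theta_2Y(t_1+t))}\big]-\mathbf{E}\big[e^{i\theta_1Y(t_1)}\big]\,\mathbf{E}\big[e^{i\theta_2Y(t_1+t)}\big].$$ Then for any $t_1\in\mathbf{R}$ and any $\theta_1,\theta_2\in\mathbf{R}$ with $\theta_1\theta_2\ne0$, $$e^{-\lambda bt}\,t^{Ha-1}\ \preceq\ R_{t_1}(t)\ \preceq\ e^{-\lambda at}\,t^{Hb-1}.$$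
   Context: Conventions: $(x)_+=\max\{x,0\}$ and $0^\gamma=0$ for all $\gamma\in\mathbf{R}$. Set $$G_{H,\alpha(x),\lambda}(t,x)=e^{-\lambda(t-x)_+}(t-x)_+^{H-\frac1{\alpha(x)}}-e^{-\lambda(-x)_+}(-x)_+^{H-\frac1{\alpha(x)}} .$$ The multistable stochastic integral $I(f)=\int f(x)\,dM_\alpha(x)$, defined for measurable $f$ with $\int_{-\infty}^\infty|f(x)|^{\alpha(x)}dx<\infty$, is specified by its finite-dimensional distributions: $\mathbf{E}[e^{i\sum_{k=1}^d\theta_kI(f_k)}]=\exp\{-\int_{-\infty}^\infty|\sum_{k=1}^d\theta_kf_k(x)|^{\alpha(x)}dx\}$. The linear tempered fractional multistable motion (LTFmSM) is $X_{H,\alpha(x),\lambda}(t)=\int_{-\infty}^\infty G_{H,\alpha(x),\lambda}(t,x)\,dM_\alpha(x)$, $t\in\mathbf{R}$; thus $$\mathbf{E}\Big[e^{i\sum_{k=1}^d\theta_kX_{H,\alpha(x),\lambda}(t_k)}\Big]=\exp\Big\{-\int_{-\infty}^\infty\Big|\sum_{k=1}^d\theta_kG_{H,\alpha(x),\lambda}(t_k,x)\Big|^{\alpha(x)}dx\Big\}.$$ For real functions $f,g$, the notation $f(t)\preceq g(t)$ means that there is $0<C<\infty$ such that $|f(t)/g(t)|\le C$ for all sufficiently large $t>0$. *)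

(* Defs.v *)
From HB Require Import structures.
From mathcomp Require Import all_boot all_order all_algebra.
From mathcomp Require Import all_classical all_reals all_analysis.
From mathcomp Require Import complex.

Set Implicit Arguments.
Unset Strict Implicit.
Unset Printing Implicit Defensive.

Import Order.TTheory GRing.Theory Num.Theory numFieldNormedType.Exports.

Local Open Scope classical_set_scope.
Local Open Scope ring_scope.
Local Open Scope complex_scope.

Definition expi (R : realType) (x : R) : R[i] := cos x +i* sin x.

(* Componentwise expectation; [fine] is harmless on the bounded random
   variables e^{iZ} to which it is applied. *)
Definition cexpectation (d : measure_display) (T : measurableType d)
    (R : realType) (P : probability T R) (Z : T -> R[i]) : R[i] :=
  fine ('E_P[fun w => complex.Re (Z w)])%E
  +i* fine ('E_P[fun w => complex.Im (Z w)])%E.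

(* (x)_+ ^ g, with 0 ^ g = 0 for every real g; the library's [powR] differs
   at 0 `^ 0 = 1. *)
Definition pospow (R : realType) (x g : R) : R :=
  if 0 < x then x `^ g else 0.

Definition G_kernel (R : realType) (H : R) (alpha : R -> R) (lambda t x : R) : R :=
  expR (- lambda * Num.max (t - x) 0) * pospow (t - x) (H - (alpha x)^-1)
  - expR (- lambda * Num.max (- x) 0) * pospow (- x) (H - (alpha x)^-1).

Definition multistable_integrable (R : realType) (alpha : R -> R) (f : R -> R) : Prop :=
  measurable_fun setT f /\
  (\int[@lebesgue_measure R]_x (`|f x| `^ alpha x)%:E < +oo)%E.

(* [I f] stands for the stochastic integral of f against M_alpha; its values
   at non-integrable f are unconstrained. The exponent is a real-valued
   (Rintegral) integral, finite for integrable f_k since alpha is bounded. *)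
Definition multistable_integral (d : measure_display) (T : measurableType d)
    (R : realType) (P : probability T R) (alpha : R -> R)
    (I : (R -> R) -> {RV P >-> R}) : Prop :=
  forall (n : nat) (theta : 'I_n -> R) (f : 'I_n -> R -> R),
    (forall k, multistable_integrable alpha (f k)) ->
    cexpectation P (fun w => expi (\sum_(k < n) theta k * I (f k) w)) =
    (expR (- \int[@lebesgue_measure R]_x
               (`|\sum_(k < n) theta k * f k x| `^ alpha x)))%:C.

(* Linear tempered fractional multistable motion. *)
Definition LTFmSM (d : measure_display) (T : measurableType d)
    (R : realType) (P : probability T R) (I : (R -> R) -> {RV P >-> R})
    (H : R) (alpha : R -> R) (lambda t : R) : {RV P >-> R} :=
  I (G_kernel H alpha lambda t).

Definition noise (T : Type) (R : realType) (X : R -> T -> R) (t : R) (w : T) : R :=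
  X (t + 1) w - X t w.

Definition codependence (d : measure_display) (T : measurableType d)
    (R : realType) (P : probability T R) (Y : R -> T -> R)
    (theta1 theta2 t1 t : R) : R[i] :=
  cexpectation P (fun w => expi (theta1 * Y t1 w + theta2 * Y (t1 + t) w))
  - cexpectation P (fun w => expi (theta1 * Y t1 w))
    * cexpectation P (fun w => expi (theta2 * Y (t1 + t) w)).

(* [g t != 0] rules out the convention z / 0 = 0, so that the quotient is
   meaningful. The relation is taken on complex-valued functions because
   [codependence] is an expression in R[i]; real functions embed by %:C, and
   the inequality then compares the real modulus of f t / g t with C. *)
Definition preceq (R : realType) (f g : R -> R[i]) : Prop :=
  exists C : R, 0 < C /\
    \forall t \near +oo, g t != 0 /\ `|f t / g t| <= C%:C.

(* Main.v *)
Require Import Defs.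
From HB Require Import structures.
From mathcomp Require Import all_boot all_order all_algebra.
From mathcomp Require Import all_classical all_reals all_analysis.
From mathcomp Require Import measurable_realfun complex ring lra.

(** Write k(u, x) for the moving-average kernel
    exp (- lambda (u - x)_+) (u - x)_+ ^ (H - 1/alpha(x)), f_u = k(u + 1) - k(u),
    A = theta1 f_{t1} and B = theta2 f_{t1 + t}.  The codependence is
    exp (- int |A + B|^alpha) - exp (- int |A|^alpha - int |B|^alpha), so up to
    constants independent of t it is the gap
    D = int (|A|^alpha + |B|^alpha - |A + B|^alpha) >= 0.

    Since A vanishes on x >= t1 + 1 and the integrand of D is at most 2 |B|^alpha,
    D is at most the tail of int |B|^alpha on x <= t1 + 1, which decays like
    exp (- lambda a t) t^(H b - 1).  For large t one has |B| <= |A| on [t1, t1 + 1),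
    where the integrand is then at least (1 - b) |B|^alpha by Bernoulli's inequality;
    this is at least a multiple of exp (- lambda b t) t^(H a - 1). *)

Import Order.TTheory GRing.Theory Num.Theory numFieldNormedType.Exports.

Local Open Scope classical_set_scope.
Local Open Scope ring_scope.
Local Open Scope complex_scope.

(** * Elementary inequalities for real powers *)

(** With [s = x + y], a ratio [z / s] in [[0, 1]] is at most its [p]-th power, so
    [s ^ p * (z / s) <= z ^ p]. Adding the cases [z = x] and [z = y] gives the claim. *)
Lemma powR_subadditive (R : realType) (x y p : R) : 0 <= x -> 0 <= y ->
  0 < p -> p <= 1 -> (x + y) `^ p <= x `^ p + y `^ p.
Proof.
move=> x0 y0 p0 p1; have xy0 : 0 <= x + y by exact: addr_ge0.
have [s0|s0] := eqVneq (x + y) 0.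
  by rewrite s0 powR0 ?gt_eqF// addr_ge0// powR_ge0.
have sgt0 : 0 < x + y by rewrite lt_neqAle eq_sym s0.
have scale z : 0 <= z -> z <= x + y -> (x + y) `^ p * (z / (x + y)) <= z `^ p.
  move=> z0 zs; rewrite -[in leRHS](divfK s0 z) mulrC powRM ?divr_ge0//.
  rewrite ler_pM2r ?powR_gt0//.
  have [->|zn0] := eqVneq z 0; first by rewrite mul0r powR0 ?gt_eqF.
  apply: ger1_powR => //; rewrite divr_gt0//=; last by rewrite lt_neqAle eq_sym zn0.
  by rewrite ler_pdivrMr// mul1r.
rewrite -[leLHS]mulr1 -(divff s0) mulrDl mulrDr.
by rewrite lerD// scale// ?lerDl ?lerDr.
Qed.

Lemma powR_normD (R : realType) (x y p : R) : 0 < p -> p <= 1 ->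
  `|x + y| `^ p <= `|x| `^ p + `|y| `^ p.
Proof.
move=> p0 p1; apply: le_trans (powR_subadditive _ _ _ _ _ _ p0 p1) => //.
by rewrite ge0_ler_powR ?ler_normD ?nnegrE// ?ltW// addr_ge0.
Qed.

(* For r = |y| / |x| <= 1, (1 + r) `^ p <= 1 + p * r <= 1 + p * r `^ p. *)
Lemma powR_normD_gap (R : realType) (x y p : R) : 0 < p -> p <= 1 ->
  `|y| <= `|x| -> `|x + y| `^ p <= `|x| `^ p + p * `|y| `^ p.
Proof.
move=> p0 p1 yx.
have [x0|x0] := eqVneq x 0.
  have -> : y = 0 by apply/eqP; rewrite -normr_le0 -(normr0 R) -x0.
  by rewrite x0 addr0 normr0 powR0 ?gt_eqF// mulr0 addr0.
have nx : 0 < `|x| by rewrite normr_gt0.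
set r := `|y| / `|x|.
have r0 : 0 <= r by rewrite divr_ge0.
have r1 : r <= 1 by rewrite ler_pdivrMr// mul1r.
have yE : `|y| = `|x| * r by rewrite mulrC divfK// gt_eqF.
have h1 : `|x + y| `^ p <= `|x| `^ p * (1 + r) `^ p.
  rewrite -powRM ?addr_ge0// mulrDr mulr1 -yE.
  by rewrite ge0_ler_powR ?ler_normD ?nnegrE ?addr_ge0// ltW.
apply: (le_trans h1); rewrite yE powRM// mulrCA -{2}[_ `^ p]mulr1 -mulrDr.
rewrite ler_pM2l ?powR_gt0//.
have bern : (1 + r) `^ p <= 1 + p * r.
  have r10 : 0 < 1 + r by rewrite ltr_pwDl.
  rewrite /powR (gt_eqF r10).
  pose q := 1 + p * r.
  have q0 : 0 < q by rewrite ltr_pwDl// mulr_ge0// ltW.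
  rewrite -[leRHS](lnK (x:=q)) ?posrE// ler_expR.
  (* Bernoulli's inequality is read off from concavity of [ln] at the points [1 + r] and [1] with
     weights [p] and [1 - p], since [ln 1 = 0]. *)
  have := concave_ln (Itv01 (ltW p0) p1) r10 (@ltr01 R).
  rewrite !convRE/= ln1 mulr0 addr0 mulr1.
  suff -> : p * (1 + r) + unstable.onem p = q by [].
  by rewrite /q /unstable.onem; ring.
apply: (le_trans bern); rewrite lerD2l ler_pM2l//.
have [->|rn0] := eqVneq r 0; first by rewrite powR0 ?gt_eqF.
by apply: ger1_powR => //; rewrite r1 andbT lt_neqAle eq_sym rn0.
Qed.

Lemma le0_ger_powR (R : realType) (p x y : R) : p <= 0 -> 0 < x -> x <= y ->
  y `^ p <= x `^ p.
Proof.
move=> p0 x0 xy; have y0 := lt_le_trans x0 xy.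
rewrite -(opprK p) !(powRN _ (- p)) lef_pV2 ?posrE ?powR_gt0//.
by apply: ge0_ler_powR => //; rewrite ?oppr_ge0 ?nnegrE ?(ltW x0) ?(ltW y0).
Qed.

(** * Measurability of powers with variable exponent *)

(** Base and exponent both vary, so [powR] is unfolded: it is [exp (g ln f)] where [f] is nonzero
    and the indicator of [g = 0] elsewhere. *)
Lemma measurable_powR2 (R : realType) (f g : R -> R) : measurable_fun setT f ->
  measurable_fun setT g -> measurable_fun setT (fun x => f x `^ g x).
Proof.
move=> mf mg; rewrite /powR.
apply: measurable_fun_ifT => //=.
- by apply: measurable_fun_eqr => //; exact: measurable_cst.
- apply: (measurableT_comp (f := fun b : bool => b%:R : R)) => //.
  by apply: measurable_fun_eqr => //; exact: measurable_cst.
- apply: measurableT_comp => //; apply: measurable_funM => //.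
  by apply: measurableT_comp => //; exact: measurable_ln.
Qed.

Lemma measurable_pospow (R : realType) (f g : R -> R) :
  measurable_fun setT f -> measurable_fun setT g ->
  measurable_fun setT (fun x => pospow (f x) (g x)).
Proof.
move=> mf mg; rewrite /pospow; apply: measurable_fun_ifT => //=.
  by apply: measurable_fun_ltr => //; exact: measurable_cst.
exact: measurable_powR2.
Qed.

(** * Lebesgue integrals of powers and exponentials *)

Section integral_bounds.
Context {R : realType}.
Notation mu := (@lebesgue_measure R).

Lemma integral_derive (F f : R -> R) (u v : R) : u < v ->
  (forall x, u <= x <= v -> is_derive x 1 F (f x)) ->
  (forall x, u <= x <= v -> {for x, continuous f}) ->
  (\int[mu]_(x in `[u, v]) (f x)%:E = (F v - F u)%:E)%E.
Proof.
move=> uv dF cf.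
have cF x : u <= x <= v -> {for x, continuous F}.
  move=> xuv; apply: differentiable_continuous; apply/derivable1_diffP.
  by have [] := dF _ xuv.
rewrite EFinB; apply: continuous_FTC2 => //.
- by apply/continuous_within_itvP => //; split => [x /[!in_itv]/= /andP[ux xv]||];
    [apply: cf; rewrite !ltW|apply: cvg_at_right_filter; apply: cf; rewrite lexx ltW|
     apply: cvg_at_left_filter; apply: cf; rewrite lexx ltW].
- split.
  + move=> x /[!in_itv]/= /andP[ux xv].
    by have [|//] := dF x; rewrite !ltW.
  + by apply: cvg_at_right_filter; apply: cF; rewrite lexx ltW.
  + by apply: cvg_at_left_filter; apply: cF; rewrite lexx ltW.
- move=> x /[!in_itv]/= /andP[ux xv].
  by have [|_] := dF x; [rewrite !ltW|rewrite derive1E].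
Qed.

(** Monotone convergence along increasing domains. It reduces integrals with an endpoint singularity
    or over a half-line to compact intervals. *)
Lemma integral_bigcup_le (D : (set R)^nat) (f : R -> \bar R) (M : \bar R) :
  nondecreasing_seq D -> (forall n, measurable (D n)) ->
  measurable_fun setT f -> (forall x, 0 <= f x)%E ->
  (forall n, \int[mu]_(x in D n) f x <= M)%E ->
  (\int[mu]_(x in \bigcup_n D n) f x <= M)%E.
Proof.
move=> ndD mD mf f0 fM.
have mf' i : measurable_fun (D i) f by exact: measurable_funS mf.
have DM : (\int[mu]_(x in D i) f x @[i --> \oo] -->
    \int[mu]_(x in \bigcup_i D i) f x)%E.
  by apply: ge0_nondecreasing_set_cvg_integral.
rewrite -(cvg_lim _ DM)//.
apply: lime_le; last by near=> n; exact: fM.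
apply: ereal_nondecreasing_is_cvgn.
exact: ge0_nondecreasing_set_nondecreasing_integral.
Unshelve. all: by end_near. Qed.

Lemma ge0_le_integral_EFin (D : set R) (f g : R -> R) : measurable D ->
  measurable_fun setT f -> measurable_fun setT g ->
  (forall x, D x -> 0 <= f x) -> (forall x, D x -> f x <= g x) ->
  (\int[mu]_(x in D) (f x)%:E <= \int[mu]_(x in D) (g x)%:E)%E.
Proof.
move=> mD mf mg f0 fg.
have mE h : measurable_fun setT h -> measurable_fun D (EFin \o h).
  by move=> mh; apply/measurable_EFinP; exact: measurable_funTS.
apply: ge0_le_integral; [done| | |exact: mE|]; last by move=> x Dx; rewrite lee_fin fg.
- by move=> x Dx; rewrite lee_fin f0.
- exact: mE.
Qed.

Lemma ge0_integralZl_EFin (D : set R) (c : R) (f : R -> R) : measurable D ->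
  measurable_fun setT f -> (forall x, D x -> 0 <= f x) -> 0 <= c ->
  (\int[mu]_(x in D) (c * f x)%:E = c%:E * \int[mu]_(x in D) (f x)%:E)%E.
Proof.
move=> mD mf f0 c0; rewrite -ge0_integralZl//.
by apply/measurable_EFinP; exact: measurable_funTS.
Qed.

Lemma ge0_integralD_EFin (D : set R) (f g : R -> R) : measurable D ->
  measurable_fun setT f -> measurable_fun setT g ->
  (forall x, D x -> 0 <= f x) -> (forall x, D x -> 0 <= g x) ->
  (\int[mu]_(x in D) (f x + g x)%:E =
   \int[mu]_(x in D) (f x)%:E + \int[mu]_(x in D) (g x)%:E)%E.
Proof.
move=> mD mf mg f0 g0; rewrite -ge0_integralD//; apply/measurable_EFinP;
  exact: measurable_funTS.
Qed.

(** The integrand may blow up at [t]. On [[t - 1, t - e n]] the antiderivative [- (t - x) ^ p / p]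
    gives [(1 - e n ^ p) / p], which is at most [1 / p] for every [n]. *)
Lemma integral_powR_subl_le (p t : R) : 0 < p ->
  (\int[mu]_(x in `[(t - 1)%R, t[) ((t - x) `^ (p - 1))%:E <= (p^-1)%:E)%E.
Proof.
(* The offset 2 makes [e n < 1], so that [[t - 1, t - e n]] is nondegenerate. *)
move=> p0; pose e (n : nat) : R := n.+2%:R^-1.
have e0 n : 0 < e n by rewrite invr_gt0.
have e1 n : e n < 1 by rewrite invf_lt1// ltr1n.
have -> : `[(t - 1)%R, t[%classic = \bigcup_n `[(t - 1)%R, (t - e n)%R]%classic :> set R.
  apply/seteqP; split => x /=; rewrite in_itv/=.
    move=> /andP[tx xt].
    have tx0 : 0 < t - x by rewrite subr_gt0.
    have [n hn] : exists n : nat, (t - x)^-1 < n%:R.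
      by exists (Num.bound (t - x)^-1); apply: archi_boundP; rewrite invr_ge0 ltW.
    exists n => //=; rewrite in_itv/= tx/= lerBrDl -lerBrDr.
    rewrite -[leRHS]invrK lef_pV2 ?posrE ?invr_gt0//.
    by rewrite ltW// (lt_trans hn)// ltr_nat; exact: leqnSn.
  move=> [n _]; rewrite /= in_itv/= => /andP[-> xt] /=.
  by rewrite (le_lt_trans xt)// ltrBlDr ltrDl.
apply: integral_bigcup_le => //.
- move=> m n mn; apply/subsetPset => x; rewrite /= !in_itv/= => /andP[-> xm]/=.
  by rewrite (le_trans xm)// lerD2l lerN2 lef_pV2 ?posrE// ler_nat.
- apply/measurable_EFinP; apply: measurable_powR2 => //.
  exact: measurable_funB.
- by move=> x; rewrite lee_fin powR_ge0.
- move=> n.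
  have pn0 : p != 0 by rewrite gt_eqF.
  have pos x : t - 1 <= x <= t - e n -> 0 < t - x.
    by move=> /andP[_ xt]; rewrite subr_gt0 (le_lt_trans xt)// ltrBlDr ltrDl.
  have dpow q x : t - 1 <= x <= t - e n ->
      is_derive x 1 (fun y => (t - y) `^ q) (- (q * (t - x) `^ (q - 1))).
    move=> /pos tx0.
    have d1 := is_derive1_powR q tx0.
    have d2 : is_derive x 1 (fun y => t - y) (-1).
      by apply: is_derive_eq; rewrite add0r mul1r.
    by rewrite -[X in is_derive _ _ _ X]mulrN1;
      exact: (@is_derive1_comp _ (@powR R ^~ q) (fun y => t - y)).
  have dF x : t - 1 <= x <= t - e n ->
      is_derive x 1 (fun y => (- p^-1) * (t - y) `^ p) ((t - x) `^ (p - 1)).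
    move=> hx; have d1 := dpow p x hx.
    have := is_deriveZ (- p^-1) d1.
    by rewrite [X in is_derive _ _ _ X -> _]mulrNN mulrA mulVf// mul1r.
  have cf x : t - 1 <= x <= t - e n ->
      {for x, continuous (fun y => (t - y) `^ (p - 1))}.
    move=> hx; apply: differentiable_continuous; apply/derivable1_diffP.
    by have [] := dpow (p - 1) x hx.
  rewrite (integral_derive _ _ _ _ _ dF cf) ?ltrD2l ?ltrN2//.
  rewrite lee_fin !subKr powR1/= mulr1 opprK gerDr.
  by rewrite mulNr oppr_le0 mulr_ge0 ?powR_ge0// invr_ge0 ltW.
Qed.

(** On [[v - (n + 1), v]] the antiderivative is [exp (- c (t - x)) / c]; dropping its nonnegative
    value at the left end leaves a bound free of [n]. *)
Lemma integral_expR_tail_le (c t v : R) : 0 < c ->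
  (\int[mu]_(x in `]-oo, v]) (expR (- c * (t - x)))%:E <=
   (expR (- c * (t - v)) / c)%:E)%E.
Proof.
move=> c0.
have -> : `]-oo, v]%classic = \bigcup_n `[(v - n.+1%:R)%R, v]%classic :> set R.
  apply/seteqP; split => x /=; rewrite in_itv/=.
    move=> xv; have [n hn] : exists n : nat, v - x < n%:R.
      by exists (Num.bound (v - x)); apply: archi_boundP; rewrite subr_ge0.
    exists n => //=; rewrite in_itv/= xv andbT lerBlDr -lerBlDl ltW//.
    by rewrite (lt_trans hn)// ltr_nat.
  by move=> [n _]; rewrite /= in_itv/= => /andP[_].
have dexp (x : R) : is_derive x 1 (fun y => expR (- c * (t - y))) (c * expR (- c * (t - x))).
  have d2 : is_derive x 1 (fun y => - c * (t - y)) c.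
    apply: is_derive_eq; rewrite /GRing.scale/=; ring.
  by rewrite [X in is_derive _ _ _ X]mulrC;
    exact: (@is_derive1_comp _ expR (fun y => - c * (t - y))).
have cexp (x : R) : {for x, continuous (fun y => expR (- c * (t - y)))}.
  apply: differentiable_continuous; apply/derivable1_diffP.
  by have [] := dexp x.
apply: integral_bigcup_le => //.
- move=> m n mn; apply/subsetPset => x; rewrite /= !in_itv/= => /andP[xm ->]/=.
  by rewrite andbT (le_trans _ xm)// lerD2l lerN2 ler_nat.
- apply/measurable_EFinP; exact: continuous_measurable_fun.
- move=> n.
  have dF x : v - n.+1%:R <= x <= v ->
      is_derive x 1 (fun y => c^-1 * expR (- c * (t - y))) (expR (- c * (t - x))).
    move=> _; have d1 := dexp x.
    have := is_deriveZ c^-1 d1.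
    by rewrite [X in is_derive _ _ _ X -> _]mulrA mulVf ?gt_eqF// mul1r.
  rewrite (integral_derive _ _ _ _ _ dF (fun x _ => cexp x)) ?ltrBlDr ?ltrDl ?ltr0Sn//.
  by rewrite lee_fin [leRHS]mulrC gerBl mulr_ge0 ?expR_ge0// invr_ge0 ltW.
Qed.
End integral_bounds.

(** * The tempered kernel and the integral of its [alpha]-th power *)

(** Common shape of both terms of [G_kernel]. The subtracted term is the case [u = 0] and cancels in
    the increments of the motion. *)
Definition tempered_kernel {R : realType} (H : R) (alpha : R -> R) (lambda u x : R) : R :=
  expR (- lambda * Num.max (u - x) 0) * pospow (u - x) (H - (alpha x)^-1).

Section tempered_kernel.
Context {R : realType} (a b H lambda : R) (alpha : R -> R).
Hypotheses (ha : 0 < a) (hb : b < 1) (halpha : forall x : R, a <= alpha x <= b).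
Hypothesis calpha : continuous alpha.
Hypotheses (hH0 : 0 < H) (hH1 : H < 1) (hlambda : 0 < lambda).
Notation mu := (@lebesgue_measure R).
Notation k := (tempered_kernel H alpha lambda).

Lemma alpha_gt0 x : 0 < alpha x.
Proof. by case/andP: (halpha x) => + _; exact: lt_le_trans. Qed.

Lemma alpha_lt1 x : alpha x < 1.
Proof. by case/andP: (halpha x) => _ /le_lt_trans; apply. Qed.

Lemma alpha_le1 x : alpha x <= 1.
Proof. exact/ltW/alpha_lt1. Qed.

(** Here [H < 1 < 1 / alpha x]: the power factor of the kernel decreases in the distance [u - x] and
    is singular at distance 0. *)
Lemma expo_lt0 x : H - (alpha x)^-1 < 0.
Proof.
rewrite subr_lt0 (lt_trans hH1)// -invr1 ltf_pV2 ?posrE ?alpha_gt0//.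
exact: alpha_lt1.
Qed.

Lemma measurable_alpha : measurable_fun setT alpha.
Proof. exact: continuous_measurable_fun. Qed.

Lemma measurable_kernel u : measurable_fun setT (k u).
Proof.
have mu_x : measurable_fun setT (fun x : R => u - x) by exact: measurable_funB.
apply: measurable_funM.
  apply: measurableT_comp => //; apply: measurable_funM => //.
  exact: measurable_maxr.
apply: measurable_pospow => //; apply: measurable_funB => //.
(* The inverse of [alpha] is viewed as its power of exponent -1, so the measurability lemma for
   powers applies. *)
under eq_fun do rewrite -(powR_inv1 (ltW (alpha_gt0 _))).
exact: measurable_powR2 measurable_alpha (measurable_cst _).
Qed.

Lemma kernel_ge0 u x : 0 <= k u x.
Proof.
rewrite mulr_ge0 ?expR_ge0// /pospow; case: ifP => // _; exact: powR_ge0.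
Qed.

Lemma kernel_eq0 u x : u <= x -> k u x = 0.
Proof. by move=> ux; rewrite /tempered_kernel /pospow subr_gt0 ltNge ux mulr0. Qed.

Lemma kernelE u x : x < u ->
  k u x = expR (- lambda * (u - x)) * (u - x) `^ (H - (alpha x)^-1).
Proof.
by move=> xu; rewrite /tempered_kernel /pospow subr_gt0 xu max_l// subr_ge0 ltW.
Qed.

(** The exponents multiply to [(H - 1 / alpha) alpha = H alpha - 1 > -1], which makes the
    singularity at [u] integrable. *)
Lemma kernel_powR u x : x < u -> k u x `^ alpha x =
  expR (- lambda * alpha x * (u - x)) * (u - x) `^ (H * alpha x - 1).
Proof.
move=> xu; rewrite kernelE// powRM ?expR_ge0 ?powR_ge0//.
rewrite -expRM -powRrM mulrBl mulVf ?gt_eqF ?alpha_gt0//.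
by congr (expR _ * _); rewrite mulrAC.
Qed.

(** At distance at most 1 a smaller exponent gives a larger power, so the worst case is
    [alpha = a]. *)
Lemma kernel_powR_near u x : u - 1 <= x < u ->
  k u x `^ alpha x <= (u - x) `^ (H * a - 1).
Proof.
move=> /andP[ux xu]; have ux0 : 0 < u - x by rewrite subr_gt0.
have ux1 : u - x <= 1 by rewrite lerBlDr -lerBlDl.
rewrite kernel_powR// -[leRHS]mul1r ler_pM ?expR_ge0 ?powR_ge0//.
  by rewrite -expR0 ler_expR !mulNr oppr_le0 ltW ?mulr_gt0 ?alpha_gt0.
have /andP[aa _] := halpha x.
by apply: ger_powR; rewrite ?ux0 ?ux1 ?lerD2r ?ler_pM2l.
Qed.

(** At distance at least 1 the power is largest for [alpha = b] and the exponential for [alpha = a].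
    This is why the upper rate mixes [a] and [b]. *)
Lemma kernel_powR_far u x : x <= u - 1 ->
  k u x `^ alpha x <= (u - x) `^ (H * b - 1) * expR (- (lambda * a) * (u - x)).
Proof.
move=> xu; have ux1 : 1 <= u - x by rewrite lerBrDr -lerBrDl.
have ux0 : 0 < u - x by exact: lt_le_trans ux1.
have /andP[aa ab] := halpha x.
rewrite kernel_powR; last by rewrite -subr_gt0.
rewrite [leLHS]mulrC; apply: ler_pM; rewrite ?expR_ge0 ?powR_ge0//.
  by apply: ler_powR; rewrite ?lerD2r ?ler_pM2l.
by rewrite ler_expR ler_pM2r// mulNr lerN2 ler_pM2l.
Qed.

Lemma expo_b_le0 : H * b - 1 <= 0.
Proof.
have b0 : 0 < b.
  by have /andP[_] := halpha 0; apply: lt_le_trans; exact: alpha_gt0.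
by rewrite subr_le0 mulr_ile1// ltW.
Qed.

Lemma powR_expo_b_le v w : 0 < v -> v <= w -> w `^ (H * b - 1) <= v `^ (H * b - 1).
Proof.
by apply: le0_ger_powR; exact: expo_b_le0.
Qed.

Lemma measurable_kernel_powR u : measurable_fun setT (fun x => k u x `^ alpha x).
Proof. exact: measurable_powR2 (measurable_kernel u) measurable_alpha. Qed.

(** The summands control the parts at distance below 1 and at least 1 from [u]; neither depends on
    [u]. *)
Definition kernel_bound : R := (H * a)^-1 + (lambda * a)^-1.

(** On [x <= v] the power factor of the far bound is largest at [x = v]. It is frozen there and the
    exponential is integrated. *)
Lemma integral_kernel_tail u v : v + 1 <= u ->
  (\int[mu]_(x in `]-oo, v]) (k u x `^ alpha x)%:E <=
   ((u - v) `^ (H * b - 1) * expR (- (lambda * a) * (u - v)) / (lambda * a))%:E)%E.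
Proof.
move=> vu.
have uv0 : 0 < u - v by rewrite subr_gt0 (lt_le_trans _ vu)// ltrDl.
have mexp : measurable_fun setT (fun x : R => expR (- (lambda * a) * (u - x))).
  by apply: measurableT_comp => //; apply: measurable_funM => //;
    exact: measurable_funB.
apply: (@le_trans _ _ (\int[mu]_(x in `]-oo, v])
    ((u - v) `^ (H * b - 1) * expR (- (lambda * a) * (u - x)))%:E)%E).
  apply: ge0_le_integral_EFin => //.
  - exact: measurable_kernel_powR.
  - by apply: measurable_funM.
  - by move=> x _; exact: powR_ge0.
  - move=> x; rewrite /= in_itv/= => xv.
    have xu : x <= u - 1 by rewrite (le_trans xv)// lerBrDr.
    apply: (le_trans (kernel_powR_far _ _ xu)).
    rewrite ler_pM2r ?expR_gt0//; apply: powR_expo_b_le => //.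
    by rewrite lerD2l lerN2.
rewrite ge0_integralZl_EFin ?powR_ge0//.
rewrite -mulrA EFinM lee_pmul2l// ?lte_fin ?powR_gt0//.
by apply: integral_expR_tail_le; rewrite mulr_gt0.
Qed.

Lemma integral_kernel_le u :
  (\int[mu]_x (k u x `^ alpha x)%:E <= kernel_bound%:E)%E.
Proof.
have m1 : measurable_fun setT (EFin \o (fun x : R => k u x `^ alpha x)).
  by apply/measurable_EFinP; exact: measurable_kernel_powR.
have -> : (setT = (`]-oo, u - 1] `|` `](u - 1)%R, u[) `|` `[u, +oo[ :> set R)%classic.
  by apply/seteqP; split => x //= _; rewrite !in_itv/= andbT;
    case: (leP x (u - 1)) => [|h]; [left; left|case: (leP u x) => [|h2]; [right|left; right]].
rewrite ge0_integral_setU//=; last 4 first.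
- exact: measurableU.
- exact: measurable_funTS.
- by move=> x _; rewrite lee_fin powR_ge0.
- apply/disj_setPS => x [] /= [] /=; rewrite !in_itv/= andbT.
    by move=> h1 h2; have := le_trans h2 h1; rewrite leNgt ltrBlDr ltrDl ltr01.
  by move=> /andP[_ h1] h2; have := le_lt_trans h2 h1; rewrite ltxx.
rewrite ge0_integral_setU//=; last 3 first.
- exact: measurable_funTS.
- by move=> x _; rewrite lee_fin powR_ge0.
- apply/disj_setPS => x [] /=; rewrite !in_itv/= => h1 /andP[h2 _].
  by have := lt_le_trans h2 h1; rewrite ltxx.
rewrite [X in (_ + X)%E]integral0_eq ?adde0; last first.
  move=> x; rewrite /= in_itv/= andbT => ux; rewrite kernel_eq0// powR0//.
  by rewrite gt_eqF// alpha_gt0.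
rewrite addeC EFinD leeD//.
- apply: le_trans (integral_powR_subl_le (H * a) u _); last by rewrite mulr_gt0.
  apply: (@le_trans _ _ (\int[mu]_(x in `](u - 1)%R, u[) ((u - x) `^ (H * a - 1))%:E)%E).
    apply: ge0_le_integral_EFin => //.
    + exact: measurable_kernel_powR.
    + by apply: measurable_powR2 => //; exact: measurable_funB.
    + by move=> x _; exact: powR_ge0.
    + move=> x; rewrite /= in_itv/= => /andP[h1 h2].
      by apply: kernel_powR_near; rewrite h2 ltW.
  apply: ge0_subset_integral => //.
  + apply/measurable_EFinP; apply: measurable_funTS; apply: measurable_powR2 => //.
    exact: measurable_funB.
  + by move=> x _; rewrite lee_fin powR_ge0.
  + by move=> x; rewrite /= !in_itv/= => /andP[/ltW -> ->].
(* At [v = u - 1] the power factor is 1, and the remaining [exp (- lambda a)] is at most 1. *)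
- have h : u - 1 + 1 <= u by rewrite subrK.
  apply: (le_trans (integral_kernel_tail _ _ h)).
  rewrite subKr powR1 mul1r lee_fin ler_pdivrMr ?mulr_gt0// mulVf ?gt_eqF ?mulr_gt0//.
  by rewrite mulr1 -expR0 ler_expR oppr_le0 ltW// mulr_gt0.
Qed.

(** * Pointwise bounds for the kernel and its increments *)

Lemma kernel_le_expR u x : x <= u - 1 -> k u x <= expR (- lambda * (u - x)).
Proof.
move=> xu; have ux1 : 1 <= u - x by rewrite lerBrDr -lerBrDl.
rewrite kernelE; last by rewrite -subr_gt0 (lt_le_trans ltr01).
by rewrite -[leRHS]mulr1 ler_pM2l ?expR_gt0// -(powRr0 (u - x)) ler_powR// ltW// expo_lt0.
Qed.

Lemma expR_le_kernel u x : u - 1 <= x < u -> expR (- lambda) <= k u x.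
Proof.
move=> /andP[ux xu]; have ux0 : 0 < u - x by rewrite subr_gt0.
have ux1 : u - x <= 1 by rewrite lerBlDr -lerBlDl.
rewrite kernelE// -[leLHS]mulr1 ler_pM ?expR_ge0//.
  by rewrite ler_expR mulNr lerN2 ger_pMr.
by rewrite -(powRr0 (u - x)) ger_powR ?ux0 ?ux1// ltW// expo_lt0.
Qed.

(** A unit shift multiplies the exponential by exactly [exp (- lambda)] and can only lower the
    power. Hence the noise kernel is comparable to [k u] on [x < u], without cancellation. *)
Lemma kernelD1_le u x : x < u -> k (u + 1) x <= expR (- lambda) * k u x.
Proof.
move=> xu; have xu1 : x < u + 1 by rewrite (lt_trans xu)// ltrDl.
have ux0 : 0 < u - x by rewrite subr_gt0.
rewrite !kernelE// mulrA -expRD.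
have -> : - lambda + - lambda * (u - x) = - lambda * (u + 1 - x) by ring.
rewrite ler_pM2l ?expR_gt0//; apply: le0_ger_powR; rewrite ?(ltW (expo_lt0 _))//.
by rewrite lerD2r lerDl.
Qed.

Definition noise_kernel u x : R := k (u + 1) x - k u x.

Lemma noise_kernel_eq0 u x : u + 1 <= x -> noise_kernel u x = 0.
Proof.
move=> ux; rewrite /noise_kernel !kernel_eq0 ?subrr//.
by rewrite (le_trans _ ux)// lerDl.
Qed.

Lemma norm_noise_kernel_le u x : x < u -> `|noise_kernel u x| <= k u x.
Proof.
move=> xu; have h := kernelD1_le _ _ xu.
have h1 : k (u + 1) x <= k u x.
  rewrite (le_trans h)// ler_piMl ?kernel_ge0// -expR0 ler_expR oppr_le0 ltW//.
by rewrite distrC ger0_norm ?subr_ge0// gerBl kernel_ge0.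
Qed.

Lemma norm_noise_kernel_ge u x : x < u ->
  (1 - expR (- lambda)) * k u x <= `|noise_kernel u x|.
Proof.
move=> xu; rewrite distrC (le_trans _ (ler_norm _))// mulrBl mul1r lerD2l lerN2.
exact: kernelD1_le.
Qed.

(** * Multistable integrability *)

Lemma measurable_norm_powR (f : R -> R) : measurable_fun setT f ->
  measurable_fun setT (fun x => `|f x| `^ alpha x).
Proof.
move=> mf; apply: measurable_powR2 => //; last exact: measurable_alpha.
exact: measurableT_comp.
Qed.

Lemma multistable_integrableP (f : R -> R) : multistable_integrable alpha f ->
  mu.-integrable setT (EFin \o (fun x => `|f x| `^ alpha x)).
Proof.
move=> [mf fi]; apply/integrableP; split.
  by apply/measurable_EFinP; exact: measurable_norm_powR.
rewrite (_ : \int[_]_(x in _) _ = \int[mu]_x (`|f x| `^ alpha x)%:E)%E//.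
by apply: eq_integral => x _; rewrite /= ger0_norm ?powR_ge0.
Qed.

Lemma multistable_integrableD (f g : R -> R) : multistable_integrable alpha f ->
  multistable_integrable alpha g -> multistable_integrable alpha (fun x => f x + g x).
Proof.
move=> [mf fi] [mg gi]; split; first exact: measurable_funD.
apply: le_lt_trans (lte_add_pinfty fi gi).
have mf' := measurable_norm_powR _ mf; have mg' := measurable_norm_powR _ mg.
rewrite -ge0_integralD_EFin//.
apply: ge0_le_integral_EFin => //.
- by apply: measurable_norm_powR; exact: measurable_funD.
- exact: measurable_funD.
- by move=> x _; apply: powR_normD; rewrite ?alpha_gt0 ?alpha_le1.
Qed.

(** Enlarging [|c|] to [1 + |c| >= 1] allows its power to be bounded by itself, which removes the
    dependence on [x]. *)
Lemma norm_powR_scale_le c y x : `|c * y| `^ alpha x <= (1 + `|c|) * `|y| `^ alpha x.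
Proof.
rewrite normrM powRM// ler_wpM2r ?powR_ge0//.
apply: (@le_trans _ _ ((1 + `|c|) `^ alpha x)).
  by rewrite ge0_ler_powR ?nnegrE ?addr_ge0 ?lerDr// ltW// alpha_gt0.
by rewrite ler1_powR ?lerDl// alpha_le1.
Qed.

Lemma multistable_integrableZ c (f : R -> R) : multistable_integrable alpha f ->
  multistable_integrable alpha (fun x => c * f x).
Proof.
move=> [mf fi]; split; first exact: measurable_funM.
apply: (@le_lt_trans _ _ ((1 + `|c|)%:E * \int[mu]_x (`|f x| `^ alpha x)%:E)%E).
  have mf' := measurable_norm_powR _ mf.
  rewrite -ge0_integralZl_EFin ?addr_ge0//.
  apply: ge0_le_integral_EFin => //.
  - by apply: measurable_norm_powR; exact: measurable_funM.
  - exact: measurable_funM.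
  - by move=> x _; exact: norm_powR_scale_le.
by rewrite lte_mul_pinfty// lee_fin addr_ge0.
Qed.

Lemma multistable_integrable_kernel u : multistable_integrable alpha (k u).
Proof.
split; first exact: measurable_kernel.
under eq_integral do rewrite (ger0_norm (kernel_ge0 _ _)).
exact: le_lt_trans (integral_kernel_le u) (ltry _).
Qed.

Lemma multistable_integrable_noise u : multistable_integrable alpha (noise_kernel u).
Proof.
rewrite /noise_kernel; under eq_fun do rewrite -mulN1r.
apply: multistable_integrableD; first exact: multistable_integrable_kernel.
by apply: multistable_integrableZ; exact: multistable_integrable_kernel.
Qed.

Lemma integral_noise_le (D : set R) c u : measurable D ->
  (\int[mu]_(x in D) (`|c * noise_kernel u x| `^ alpha x)%:E <=
  (1 + `|c|)%:E * (\int[mu]_(x in D) (k (u + 1) x `^ alpha x)%:E +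
                   \int[mu]_(x in D) (k u x `^ alpha x)%:E))%E.
Proof.
move=> mD.
have mk v := measurable_kernel_powR v.
have k0 v x : D x -> 0 <= k v x `^ alpha x by move=> _; exact: powR_ge0.
rewrite -ge0_integralD_EFin//; [|exact: k0..].
rewrite -ge0_integralZl_EFin ?addr_ge0//; last 2 first.
- exact: measurable_funD.
- by move=> x Dx; rewrite addr_ge0 ?k0.
apply: ge0_le_integral_EFin => //.
- apply: measurable_norm_powR; apply: measurable_funM => //.
  by have [] := multistable_integrable_noise u.
- by apply: measurable_funM => //; exact: measurable_funD.
- move=> x _.
  apply: (le_trans (norm_powR_scale_le _ _ _)); rewrite ler_wpM2l ?addr_ge0//.
  apply: (le_trans (powR_normD _ _ _ _ _ _)); rewrite ?alpha_gt0 ?alpha_le1//.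
  by rewrite normrN !ger0_norm ?kernel_ge0.
Qed.

(** * The subadditivity gap and its integral *)

Definition gap (f g : R -> R) (x : R) : R :=
  `|f x| `^ alpha x + `|g x| `^ alpha x - `|f x + g x| `^ alpha x.

Lemma gap_ge0 (f g : R -> R) x : 0 <= gap f g x.
Proof. by rewrite subr_ge0 powR_normD ?alpha_gt0 ?alpha_le1. Qed.

(** Subadditivity applied to [f = (f + g) - g]. The bound involves only [g], later the kernel that
    decays in [t]. *)
Lemma gap_le (f g : R -> R) x : gap f g x <= 2 * `|g x| `^ alpha x.
Proof.
have : `|f x| `^ alpha x <= `|f x + g x| `^ alpha x + `|g x| `^ alpha x.
  rewrite -[in leLHS](addrK (g x) (f x)).
  apply: (le_trans (powR_normD _ _ _ _ _ _)); rewrite ?alpha_gt0 ?alpha_le1//.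
  by rewrite normrN.
by rewrite /gap; lra.
Qed.

(** The refined subadditivity with [p = alpha x] leaves the factor [1 - alpha x], which is at least
    [1 - b]. *)
Lemma gap_ge (f g : R -> R) x : `|g x| <= `|f x| -> (1 - b) * `|g x| `^ alpha x <= gap f g x.
Proof.
move=> gf; have := powR_normD_gap _ _ _ _ (alpha_gt0 x) (alpha_le1 x) gf.
have : alpha x * `|g x| `^ alpha x <= b * `|g x| `^ alpha x.
  by rewrite ler_wpM2r ?powR_ge0//; case/andP: (halpha x).
by rewrite /gap; lra.
Qed.

Notation J := (fun f : R -> R => (\int[mu]_x (`|f x| `^ alpha x))%R).

Lemma integral_gap (f g : R -> R) :
  multistable_integrable alpha f -> multistable_integrable alpha g ->
  (\int[mu]_x (gap f g x)%:E = (J f + J g - J (fun x => (f x + g x)%R))%:E)%E.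
Proof.
move=> hf hg; have hfg := multistable_integrableD _ _ hf hg.
have [if_ ig ifg] : [/\ mu.-integrable setT (EFin \o (fun x => `|f x| `^ alpha x)),
    mu.-integrable setT (EFin \o (fun x => `|g x| `^ alpha x)) &
    mu.-integrable setT (EFin \o (fun x => `|f x + g x| `^ alpha x))].
  by split; exact: multistable_integrableP.
have ifpg : mu.-integrable setT (EFin \o (fun x => `|f x| `^ alpha x + `|g x| `^ alpha x)).
  by have := integrableD measurableT if_ ig; apply: eq_integrable.
rewrite -RintegralD// -RintegralB// /Rintegral fineK//.
apply: integrable_fin_num => //.
by have := integrableB measurableT ifpg ifg; apply: eq_integrable.
Qed.

Lemma measurable_gap (f g : R -> R) : measurable_fun setT f -> measurable_fun setT g ->
  measurable_fun setT (gap f g).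
Proof.
move=> mf mg; apply: measurable_funB; last first.
  by apply: measurable_norm_powR; exact: measurable_funD.
by apply: measurable_funD; exact: measurable_norm_powR.
Qed.

Lemma J_ge0 (f : R -> R) : 0 <= J f.
Proof. by apply: Rintegral_ge0 => x _; exact: powR_ge0. Qed.

(** Uniformity in [u] is the point: it keeps [exp (- J A - J B)] away from 0 as [t] grows. *)
Lemma J_noise_le c u : J (fun x => c * noise_kernel u x) <=
  (1 + `|c|) * (kernel_bound + kernel_bound).
Proof.
have h : (\int[mu]_x (`|c * noise_kernel u x| `^ alpha x)%:E <=
    ((1 + `|c|) * (kernel_bound + kernel_bound))%:E)%E.
  apply: (le_trans (integral_noise_le setT c u measurableT)).
  rewrite EFinM lee_wpmul2l ?lee_fin ?addr_ge0// EFinD leeD//;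
    exact: integral_kernel_le.
rewrite -lee_fin /Rintegral fineK//.
rewrite ge0_fin_numE; first exact: le_lt_trans h (ltry _).
by apply: integral_ge0 => x _; rewrite lee_fin powR_ge0.
Qed.

(** * Upper bound for the integrated gap *)

(** The power of [1 / 2] pays for passing from [t - 1] to [t] in the power, [exp (lambda a)] does so
    in the exponential, and the division comes from integrating the tail. *)
Definition tail_const : R :=
  2^-1 `^ (H * b - 1) * expR (lambda * a) / (lambda * a).

(* The smaller of the two shifts u - v in [integral_kernel_tail] is t - 1,
   and (t - 1) >= t / 2. *)
Lemma tail_shift_le t w : 2 <= t -> t - 1 <= w ->
  w `^ (H * b - 1) * expR (- (lambda * a) * w) / (lambda * a) <=
  tail_const *
  (expR (- lambda * a * t) * t `^ (H * b - 1)).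
Proof.
move=> t2 tw; have la0 : 0 < lambda * a by rewrite mulr_gt0.
have t0 : 0 < t by rewrite (lt_le_trans _ t2).
rewrite /tail_const; have -> : forall p q r s l : R, p * q / l * (r * s) = (p * s) * (q * r) / l.
  by move=> *; ring.
rewrite ler_pM2r ?invr_gt0// ler_pM ?powR_ge0 ?expR_ge0//.
  rewrite -powRM ?invr_ge0 ?(ltW t0)//; apply: powR_expo_b_le; lra.
rewrite -expRD ler_expR.
have -> : lambda * a + - lambda * a * t = - (lambda * a) * (t - 1) by ring.
by rewrite !mulNr lerN2 ler_pM2l.
Qed.

(** The outer 2 is that of [gap_le], [1 + |c2|] comes from scaling, and the doubled tail from the
    two kernels in the noise. *)
Definition gap_upper (c2 : R) : R := 2 * ((1 + `|c2|) * (tail_const *+ 2)).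

Lemma gap_upper_gt0 c2 : 0 < gap_upper c2.
Proof.
have tail0 : 0 < tail_const.
  by rewrite divr_gt0 ?mulr_gt0 ?powR_gt0 ?expR_gt0 ?invr_gt0.
have c0 : 0 < 1 + `|c2| by rewrite ltr_pwDl.
by rewrite !mulr_gt0// pmulrn_lgt0.
Qed.

Lemma integral_gap_le (c1 c2 t1 t : R) : 2 <= t ->
  (\int[mu]_x (gap (fun x => (c1 * noise_kernel t1 x)%R)
                   (fun x => (c2 * noise_kernel (t1 + t) x)%R) x)%:E <=
   (gap_upper c2 * (expR (- lambda * a * t) * t `^ (H * b - 1)))%:E)%E.
Proof.
move=> t2; set f := (fun x => c1 * _); set g := (fun x => c2 * _).
have [mf _] : multistable_integrable alpha f.
  exact/multistable_integrableZ/multistable_integrable_noise.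
have [mg _] : multistable_integrable alpha g.
  exact/multistable_integrableZ/multistable_integrable_noise.
pose D : set R := `]-oo, (t1 + 1)%R]%classic.
have mD : measurable D by exact: measurable_itv.
(* Beyond [t1 + 1] the function [f] vanishes, and the two terms in [g] cancel. *)
have -> : (\int[mu]_x (gap f g x)%:E = \int[mu]_(x in D) (gap f g x)%:E)%E.
  rewrite [RHS]integral_mkcond; apply: eq_integral => x _.
  rewrite patchE; case: ifPn => // /negP; rewrite inE /D /= in_itv/= => /negP.
  rewrite -ltNge => tx; rewrite /gap /f noise_kernel_eq0 ?ltW//.
  by rewrite mulr0 normr0 add0r powR0 ?add0r ?subrr// gt_eqF// alpha_gt0.
have mgp := measurable_norm_powR _ mg.
apply: (@le_trans _ _ (2%:E * \int[mu]_(x in D) (`|g x| `^ alpha x)%:E)%E).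
  rewrite -ge0_integralZl_EFin//.
  apply: ge0_le_integral_EFin => //.
  - exact: measurable_gap.
  - exact: measurable_funM.
  - by move=> x _; exact: gap_ge0.
  - by move=> x _; exact: gap_le.
set E := expR (- lambda * a * t) * _.
have -> : gap_upper c2 * E = 2 * ((1 + `|c2|) * (tail_const * E + tail_const * E)).
  by rewrite /gap_upper; ring.
rewrite EFinM lee_wpmul2l ?lee_fin//.
apply: (le_trans (integral_noise_le D c2 (t1 + t) mD)).
rewrite EFinM lee_wpmul2l ?lee_fin ?addr_ge0// EFinD leeD//.
(* With [v = t1 + 1] the two kernels sit at distances [t] and [t - 1]; [2 <= t] keeps both at least
   1, as the tail bound requires. *)
- apply: (le_trans (integral_kernel_tail _ _ _)); first by lra.
  by rewrite lee_fin; apply: tail_shift_le; lra.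
- apply: (le_trans (integral_kernel_tail _ _ _)); first by lra.
  by rewrite lee_fin; apply: tail_shift_le; lra.
Qed.

(** * Lower bound for the integrated gap *)

(** The minimum with 1 ensures that this factor is at most its own [alpha]-th power, whatever [x]
    is. *)
Definition gap_lower (c2 : R) : R :=
  (1 - b) * Num.min 1 (`|c2| * (1 - expR (- lambda))).

Lemma gap_lower_gt0 c2 : c2 != 0 -> 0 < gap_lower c2.
Proof.
move=> c20; rewrite mulr_gt0 ?subr_gt0// lt_min ltr01 mulr_gt0 ?normr_gt0//.
by rewrite subr_gt0 -expR0 ltr_expR oppr_lt0.
Qed.

Lemma gap_lower_ge0 c2 : 0 <= gap_lower c2.
Proof.
rewrite mulr_ge0 ?subr_ge0 ?(ltW hb)// le_min ler01 mulr_ge0//.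
by rewrite subr_ge0 -expR0 ler_expR oppr_le0 ltW.
Qed.

(** The distance [u - x] lies in [[t - 1, t]], hence is at least 1. So replacing [alpha] by [a]
    lowers the power and by [b] the exponential; both factors then decrease when the distance is
    raised to [t]. *)
Lemma norm_noise_powR_ge (c2 u t x : R) : 2 <= t -> u - t <= x <= u - t + 1 ->
  Num.min 1 (`|c2| * (1 - expR (- lambda))) *
    (expR (- lambda * b * t) * t `^ (H * a - 1)) <=
  `|c2 * noise_kernel u x| `^ alpha x.
Proof.
move=> t2 /andP[tx xt]; have xu : x < u by lra.
have ux1 : 1 <= u - x by lra.
have uxt : u - x <= t by lra.
have ux0 : 0 < u - x by lra.
have /andP[aa ab] := halpha x.
have a0 := alpha_gt0 x.
have e0 : 0 <= 1 - expR (- lambda).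
  by rewrite subr_ge0 -expR0 ler_expR oppr_le0 ltW.
set m := Num.min _ _.
have m0 : 0 <= m by rewrite le_min ler01 mulr_ge0.
have m1 : m <= 1 by rewrite ge_min lexx.
apply: (@le_trans _ _ ((m * k u x) `^ alpha x)); last first.
  rewrite ge0_ler_powR ?nnegrE ?(mulr_ge0 m0 (kernel_ge0 _ _)) ?(ltW a0)//.
  rewrite normrM (le_trans _ (ler_wpM2l _ (norm_noise_kernel_ge _ _ xu)))//.
  by rewrite [leRHS]mulrA ler_wpM2r ?kernel_ge0// ge_min lexx orbT.
rewrite powRM ?kernel_ge0// ler_pM// ?mulr_ge0 ?expR_ge0 ?powR_ge0//.
  (* The bound [m <= m ^ alpha] is applied for [0 < m <= 1]; the case [m = 0] is separate. *)
  have [->|mn0] := eqVneq m 0; first by rewrite powR_ge0.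
  by rewrite ger1_powR ?alpha_le1// m1 andbT lt_neqAle eq_sym mn0.
rewrite kernel_powR// ler_pM ?expR_ge0 ?powR_ge0//.
  rewrite ler_expR !mulNr lerN2 -!mulrA ler_pM2l// ler_pM//; first exact: ltW.
  exact: ltW.
apply: (@le_trans _ _ ((u - x) `^ (H * a - 1))); last first.
  by rewrite ler_powR// lerD2r ler_pM2l.
apply: le0_ger_powR => //; rewrite subr_le0.
by rewrite mulr_ile1 ?(ltW hH0) ?(ltW hH1) ?(ltW ha)// (le_trans aa (alpha_le1 x)).
Qed.

Lemma integral_gap_ge (c1 c2 t1 t : R) : c1 != 0 -> 2 <= t ->
  1 + `|c2| * expR lambda / (`|c1| * lambda) <= t ->
  ((gap_lower c2 * (expR (- lambda * b * t) * t `^ (H * a - 1)))%:E <=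
   \int[mu]_x (gap (fun x => (c1 * noise_kernel t1 x)%R)
                   (fun x => (c2 * noise_kernel (t1 + t) x)%R) x)%:E)%E.
Proof.
move=> c10 t2 tlarge; set f := (fun x => c1 * _); set g := (fun x => c2 * _).
have [mf _] : multistable_integrable alpha f.
  exact/multistable_integrableZ/multistable_integrable_noise.
have [mg _] : multistable_integrable alpha g.
  exact/multistable_integrableZ/multistable_integrable_noise.
(* On this interval [k t1] vanishes while [k (t1 + 1)] is at least [exp (- lambda)]. The right end
   is excluded because both vanish there. *)
pose D : set R := `[t1, (t1 + 1)%R[%classic.
have mD : measurable D by exact: measurable_itv.
have gf x : D x -> `|g x| <= `|f x|.
  rewrite /D /= in_itv/= => /andP[tx xt].
  have f1 : `|c1| * expR (- lambda) <= `|f x|.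
    rewrite normrM ler_wpM2l// /noise_kernel (kernel_eq0 t1)// subr0.
    by rewrite ger0_norm ?kernel_ge0// expR_le_kernel// xt andbT; lra.
  apply: le_trans f1.
  have g1 : `|g x| <= `|c2| * expR (- lambda * (t - 1)).
    rewrite normrM ler_wpM2l//.
    apply: (le_trans (norm_noise_kernel_le _ _ _)); first by lra.
    apply: (le_trans (kernel_le_expR _ _ _)); first by lra.
    by rewrite ler_expR !mulNr lerN2 ler_pM2l//; lra.
  apply: (le_trans g1).
  have t1p : 0 < lambda * (t - 1) by rewrite mulr_gt0//; lra.
  have nc1 : 0 < `|c1| by rewrite normr_gt0.
  (* The threshold on [t] is this inequality solved for [t]. Combined with [z exp (- z) <= 1] it
     gives [|g| <= |c1| exp (- lambda) <= |f|]. *)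
  have key : `|c2| * expR lambda <= `|c1| * (lambda * (t - 1)).
    by rewrite mulrA -ler_pdivrMl ?mulr_gt0// mulrC; lra.
  set z := lambda * (t - 1) in t1p key *.
  have zE : z * expR (- z) <= 1.
    rewrite expRN ler_pdivrMr ?expR_gt0// mul1r.
    by apply: le_trans (expR_ge1Dx z); rewrite lerDr.
  have -> : `|c2| * expR (- lambda * (t - 1)) =
      `|c2| * expR lambda * expR (- z) * expR (- lambda).
    rewrite -!mulrA -!expRD; congr (_ * expR _); rewrite /z; ring.
  rewrite ler_pM2r ?expR_gt0//.
  apply: (@le_trans _ _ (`|c1| * z * expR (- z))).
    by rewrite ler_pM2r ?expR_gt0.
  by rewrite -mulrA ler_piMr.
have mgap := measurable_gap _ _ mf mg.
set cst := gap_lower c2 * _.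
(* [D] has length 1, so a constant equals its integral over [D]. *)
have -> : cst%:E = (\int[mu]_(x in D) cst%:E)%E.
  rewrite integral_cst//= lebesgue_measure_itv/= lte_fin ltrDl ltr01.
  by rewrite -EFinB addrAC subrr add0r mule1.
apply: (@le_trans _ _ (\int[mu]_(x in D) (gap f g x)%:E)%E).
  apply: ge0_le_integral_EFin => //.
  - move=> x _; rewrite /cst mulr_ge0 ?gap_lower_ge0//.
    by rewrite mulr_ge0 ?expR_ge0 ?powR_ge0.
  - move=> x Dx; apply: le_trans (gap_ge _ _ _ (gf _ Dx)).
    rewrite /cst /gap_lower -[leLHS]mulrA ler_pM2l ?subr_gt0//.
    move: Dx; rewrite /D /= in_itv/= => /andP[tx xt].
    by apply: norm_noise_powR_ge => //; apply/andP; split; lra.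
apply: ge0_subset_integral => //; first by apply/measurable_EFinP.
by move=> x _; rewrite lee_fin gap_ge0.
Qed.

(** * Characteristic functions of the noise *)

Lemma G_kernelE t : G_kernel H alpha lambda t = (fun x => k t x + -1 * k 0 x).
Proof. by apply/funext => x; rewrite mulN1r /tempered_kernel sub0r. Qed.

Lemma multistable_integrable_G t : multistable_integrable alpha (G_kernel H alpha lambda t).
Proof.
rewrite G_kernelE; apply: multistable_integrableD.
  exact: multistable_integrable_kernel.
by apply: multistable_integrableZ; exact: multistable_integrable_kernel.
Qed.

Section codependence.
Context (d : measure_display) (T : measurableType d) (P : probability T R).
Context (I : (R -> R) -> {RV P >-> R}).
Hypothesis hI : multistable_integral alpha I.
Notation Y := (noise (fun t : R => (LTFmSM I H alpha lambda t : T -> R))).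

(** The hypothesis on [I] gives only finite-dimensional distributions, so the two noise values are
    expanded into four values of the motion with coefficients [c1, - c1, c2, - c2]. The [k 0] terms
    cancel in the exponent. *)
Lemma cexpectation_noise (c1 c2 t1 t2 : R) :
  cexpectation P (fun w => expi (c1 * Y t1 w + c2 * Y t2 w)) =
  (expR (- J (fun x => c1 * noise_kernel t1 x + c2 * noise_kernel t2 x)))%:C.
Proof.
have := hI 4 (fun i => nth 0 [:: c1; - c1; c2; - c2] i)
  (fun i => G_kernel H alpha lambda (nth 0 [:: t1 + 1; t1; t2 + 1; t2] i))
  (fun i => multistable_integrable_G _).
under eq_fun do rewrite !big_ord_recl big_ord0/=.
have E x : c1 * (k (t1 + 1) x + -1 * k 0 x) + (- c1 * (k t1 x + -1 * k 0 x) +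
    (c2 * (k (t2 + 1) x + -1 * k 0 x) + (- c2 * (k t2 x + -1 * k 0 x) + 0))) =
    c1 * noise_kernel t1 x + c2 * noise_kernel t2 x.
  by rewrite /noise_kernel; ring.
under eq_Rintegral do rewrite !big_ord_recl big_ord0/= !G_kernelE E.
move=> <-; congr cexpectation; apply/funext => w; congr expi.
by rewrite /noise /LTFmSM; ring.
Qed.

Lemma cexpectation_noise1 (c t : R) :
  cexpectation P (fun w => expi (c * Y t w)) =
  (expR (- J (fun x => c * noise_kernel t x)))%:C.
Proof.
transitivity (cexpectation P (fun w => expi (c * Y t w + 0 * Y t w))).
  by congr cexpectation; apply/funext => w; rewrite mul0r addr0.
rewrite cexpectation_noise.
by under eq_Rintegral do rewrite mul0r addr0.
Qed.

Lemma codependence_noise (c1 c2 t1 t : R) :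
  codependence P Y c1 c2 t1 t =
  (expR (- J (fun x => c1 * noise_kernel t1 x + c2 * noise_kernel (t1 + t) x)) -
   expR (- J (fun x => c1 * noise_kernel t1 x)) *
   expR (- J (fun x => c2 * noise_kernel (t1 + t) x)))%:C.
Proof.
by rewrite /codependence cexpectation_noise !cexpectation_noise1 rmorphB rmorphM.
Qed.

End codependence.

(** * From the integrated gap to the codependence *)

(** With [D = p + q - s], the middle term equals both [exp (- (p + q)) (exp D - 1)] and
    [exp (- s) (1 - exp (- D))]. Each bound follows from [1 + x <= exp x]. *)
Lemma expR_gap_bounds (p q s : R) : 0 <= s -> 0 <= p + q - s ->
  expR (- (p + q)) * (p + q - s) <= expR (- s) - expR (- p) * expR (- q) <= p + q - s.
Proof.
move=> s0 d0; set D := p + q - s in d0 *; apply/andP; split.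
  have -> : expR (- s) - expR (- p) * expR (- q) = expR (- (p + q)) * (expR D - 1).
    by rewrite mulrBr mulr1 -!expRD /D; congr (expR _ - expR _); ring.
  by rewrite ler_pM2l ?expR_gt0// lerBrDl expR_ge1Dx.
have -> : expR (- s) - expR (- p) * expR (- q) = expR (- s) * (1 - expR (- D)).
  by rewrite mulrBr mulr1 -!expRD /D; congr (expR _ - expR _); ring.
have h1 : 1 - expR (- D) <= D.
  by have := expR_ge1Dx (- D); lra.
have h2 : 0 <= 1 - expR (- D) by rewrite subr_ge0 -expR0 ler_expR oppr_le0.
apply: (le_trans _ h1); rewrite ler_piMl// -expR0 ler_expR oppr_le0//.
Qed.

Definition lower_const (c1 c2 : R) : R :=
  expR (- ((1 + `|c1|) * (kernel_bound + kernel_bound) +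
           (1 + `|c2|) * (kernel_bound + kernel_bound))) * gap_lower c2.

Lemma expR_J_bounds (c1 c2 t1 t : R) : c1 != 0 -> 2 <= t ->
  1 + `|c2| * expR lambda / (`|c1| * lambda) <= t ->
  lower_const c1 c2 * (expR (- lambda * b * t) * t `^ (H * a - 1)) <=
  expR (- J (fun x => c1 * noise_kernel t1 x + c2 * noise_kernel (t1 + t) x)) -
  expR (- J (fun x => c1 * noise_kernel t1 x)) *
  expR (- J (fun x => c2 * noise_kernel (t1 + t) x)) <=
  gap_upper c2 * (expR (- lambda * a * t) * t `^ (H * b - 1)).
Proof.
move=> c10 t2 tlarge.
have jA := J_noise_le c1 t1; have jB := J_noise_le c2 (t1 + t).
have lo := integral_gap_ge c1 c2 t1 t c10 t2 tlarge.
have up := integral_gap_le c1 c2 t1 t t2.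
have int c u := multistable_integrableZ c _ (multistable_integrable_noise u).
have d0 : (0 <= \int[mu]_x (gap (fun x => (c1 * noise_kernel t1 x)%R)
    (fun x => (c2 * noise_kernel (t1 + t) x)%R) x)%:E)%E.
  by apply: integral_ge0 => x _; rewrite lee_fin gap_ge0.
rewrite (integral_gap _ _ (int c1 t1) (int c2 (t1 + t))) !lee_fin in d0 lo up.
have s0 := J_ge0 (fun x => c1 * noise_kernel t1 x + c2 * noise_kernel (t1 + t) x).
have /andP[h1 h2] := expR_gap_bounds _ _ _ s0 d0.
rewrite (le_trans h2 up) andbT (le_trans _ h1)// /lower_const -mulrA.
apply: ler_pM; rewrite ?expR_ge0//; last by rewrite ler_expR lerN2 lerD.
apply: mulr_ge0; first exact: gap_lower_ge0.
by rewrite mulr_ge0 ?expR_ge0 ?powR_ge0.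
Qed.

End tempered_kernel.

(** * Asymptotic comparison and conclusion *)

Lemma preceq_real (R : realType) (f g : R -> R) (C : R) : 0 < C ->
  (\forall t \near +oo, 0 < g t /\ `|f t| <= C * g t) ->
  preceq (fun t => (f t)%:C) (fun t => (g t)%:C).
Proof.
move=> C0 fg; exists C; split => //; apply: filterS fg => t [g0 fgt].
split; first by rewrite fmorph_eq0 gt_eqF.
rewrite -fmorph_div normc_def/= expr0n addr0 sqrtr_sqr lecR.
by rewrite normrM normfV (gtr0_norm g0) ler_pdivrMr.
Qed.

Theorem proposition1 (R : realType) (d : measure_display)
    (T : measurableType d) (P : probability T R)
    (a b H lambda : R) (alpha : R -> R) (I : (R -> R) -> {RV P >-> R})
    (ha : 0 < a) (hab : a <= b) (hb : b < 1)
    (halpha : forall x : R, a <= alpha x <= b) (calpha : continuous alpha)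
    (hH0 : 0 < H) (hH1 : H < 1) (hlambda : 0 < lambda)
    (hI : multistable_integral alpha I)
    (t1 theta1 theta2 : R) (htheta : theta1 * theta2 != 0) :
  let X := fun t : R => (LTFmSM I H alpha lambda t : T -> R) in
  let Y := noise X in
  let Rt1 := codependence P Y theta1 theta2 t1 in
  preceq (fun t : R => (expR (- lambda * b * t) * t `^ (H * a - 1))%:C) Rt1 /\
  preceq Rt1 (fun t : R => (expR (- lambda * a * t) * t `^ (H * b - 1))%:C).
Proof.
move=> X Y Rt1.
have [th1 th2] : theta1 != 0 /\ theta2 != 0.
  by move: htheta; rewrite mulf_eq0 => /norP[].
have cod t := @codependence_noise _ _ _ _ _ _ ha hb halpha calpha hH0 hH1 hlambda
  _ _ _ _ hI theta1 theta2 t1 t.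
have bounds := @expR_J_bounds _ _ _ _ _ _ ha hb halpha calpha hH0 hH1 hlambda
  theta1 theta2 t1 _ th1.
(* The codependence is real-valued, so the comparison can be made on real parts. *)
have RE : Rt1 = (fun t => (complex.Re (Rt1 t))%:C).
  by apply/funext => t; rewrite /Rt1 cod.
have L0 : 0 < lower_const a b H lambda theta1 theta2.
  by rewrite mulr_gt0 ?expR_gt0 ?gap_lower_gt0.
have U0 : 0 < gap_upper a b H lambda theta2 by exact: gap_upper_gt0.
pose thr : R := 1 + `|theta2| * expR lambda / (`|theta1| * lambda).
have main : \forall t \near +oo, 0 < t /\
    lower_const a b H lambda theta1 theta2 *
      (expR (- lambda * b * t) * t `^ (H * a - 1)) <= complex.Re (Rt1 t) <=
    gap_upper a b H lambda theta2 * (expR (- lambda * a * t) * t `^ (H * b - 1)).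
  near=> t; have t2 : 2 <= t by near: t; apply: nbhs_pinfty_ge; exact: num_real.
  have tthr : thr <= t by near: t; apply: nbhs_pinfty_ge; exact: num_real.
  by split; [by rewrite (lt_le_trans _ t2)|rewrite /Rt1 cod/=; exact: bounds].
have g0 (c e t : R) : 0 < t -> 0 < expR c * t `^ e.
  by move=> t0; rewrite mulr_gt0 ?expR_gt0 ?powR_gt0.
rewrite RE; split.
(* The codependence is now the denominator: its lower bound gives both the constant, inverted, and
   its positivity. *)
- apply: (preceq_real _ _ _ (lower_const a b H lambda theta1 theta2)^-1).
    by rewrite invr_gt0.
  apply: filterS main => t [t0 /andP[lo _]]; split.
    by apply: lt_le_trans lo; rewrite mulr_gt0 ?g0.
  by rewrite gtr0_norm ?g0// ler_pdivlMl.
- apply: (preceq_real _ _ _ (gap_upper a b H lambda theta2)) => //.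
  apply: filterS main => t [t0 /andP[lo up]]; split; first exact: g0.
  by rewrite ger0_norm// (le_trans _ lo)// mulr_ge0 ?ltW ?g0.
Unshelve. all: by end_near. Qed.
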